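(* Let $X$ be a topological space. If $X$ is Scheepers, then the Alexandroff duplicate $AD(X)$ is star-$K$-Scheepers.
   Context: The Alexandroff duplicate of $X$ is $AD(X)=X\times\{0,1\}$ topologized as follows: each point of $X\times\{1\}$ is isolated, and a basic neighbourhood of $(x,0)\in X\times\{0\}$ is a set of the form $(U\times\{0\})\cup((U\times\{1\})\setminus\{(x,1)\})$, where $U$ is a neighbourhood of $x$ in $X$. For a subset $A$ of a space $Z$ and a collection $\mathcal{P}$ of subsets of $Z$, $St(A,\mathcal{P})=\bigcup\{B\in\mathcal{P}: A\cap B\neq\emptyset\}$. An open cover $\mathcal{U}$ of $Z$ is an $\omega$-cover if each finite $F\subseteq Z$ is contained in some $U\in\mathcal{U}$ (the set $Z$ itself is allowed to be a member). $Z$ is Scheepers if for each sequence $(\mathcal{U}_n)_{n\in\mathbb{N}}$ of open covers of $Z$ there are finite $\mathcal{V}_n\subseteq\mathcal{U}_n$ ($n\in\mathbb{N}$) such that $\{\bigcup\mathcal{V}_n: n\in\mathbb{N}\}$ is an $\omega$-cover of $Z$ or $\bigcup\mathcal{V}_n=Z$ for some $n$. $Z$ is star-$K$-Scheepers if for each sequence $(\mathcal{U}_n)_{n\in\mathbb{N}}$ of open covers of $Z$ there is a sequence $(K_n)_{n\in\mathbb{N}}$ of compact subsets of $Z$ such that $\{St(K_n,\mathcal{U}_n): n\in\mathbb{N}\}$ is an $\omega$-cover of $Z$. *)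

(* Defs.v *)
From HB Require Import structures.
From mathcomp Require Import all_boot all_classical topology.

Set Implicit Arguments.
Unset Strict Implicit.
Unset Printing Implicit Defensive.

Local Open Scope classical_set_scope.

(* [(x, false)] and [(x, true)] stand for the points (x, 0) and (x, 1). The
   alias keeps the product topology from being inferred on [AD X]. *)
Definition AD (X : Type) : Type := (X * bool)%type.

Section AlexandroffDuplicate.
Context {X : topologicalType}.

HB.instance Definition _ := Choice.copy (AD X) (X * bool)%type.

Definition AD_basic_nbhs (x : X) (U : set X) : set (AD X) :=
  (U `*` [set false]) `|` ((U `*` [set true]) `\ (x, true)).

Definition AD_local (p : AD X) : set_system (AD X) :=
  if p.2 then principal_filter p
  else filter_from (nbhs p.1) (AD_basic_nbhs p.1).

(* A set is open when it contains a basic neighbourhood of each of its points.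
   If X is not T1, a basic neighbourhood of (x, 0) need not be a neighbourhood
   for this topology; if X is T1 it is (lemma [AD_nbhsE]). *)
Definition AD_open : set_system (AD X) :=
  [set A | forall p, A p -> AD_local p A].

Let AD_local_filter (p : AD X) : Filter (AD_local p).
Proof.
case: p => x [] /=; first by case: (principal_filter_proper (x, true)).
rewrite /AD_local /=; apply: filter_from_filter.
  by exists setT; exact: filterT.
move=> U V nU nV; exists (U `&` V); first exact: filterI.
by move=> [y b] [[[Uy Vy] /= ->]|[[[Uy Vy] /= ->] yx]];
  split; [left|left|right|right].
Qed.

Let AD_openT : AD_open setT.
Proof. by move=> p _; exact: (@filterT _ _ (AD_local_filter p)). Qed.

Let AD_openI : setI_closed AD_open.
Proof.
by move=> A B oA oB p [/oA pA /oB pB]; exact: (@filterI _ _ (AD_local_filter p)).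
Qed.

Let AD_open_bigU (I : Type) (f : I -> set (AD X)) :
  (forall i, AD_open (f i)) -> AD_open (\bigcup_i f i).
Proof.
move=> of_ p [i _ /of_]; apply: (@filterS _ _ (AD_local_filter p)) => q fq.
by exists i.
Qed.

HB.instance Definition _ := isOpenTopological.Build (AD X)
  AD_openT AD_openI AD_open_bigU.

Lemma AD_openE (A : set (AD X)) : open A = AD_open A.
Proof. by []. Qed.

Lemma AD_nbhsE (p : AD X) : accessible_space X -> nbhs p = AD_local p.
Proof.
move=> T1X; rewrite eqEsubset; split=> A; rewrite nbhsE.
  move=> [B [+ Bp] BA]; rewrite AD_openE => oB.
  by apply: (@filterS _ _ (AD_local_filter p) _ _ BA); exact: oB.
case: p => x [] /=; rewrite /AD_local /=.
  move/principal_filterP => Ax; exists [set (x, true)]; last by move=> _ ->.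
  by split=> //; rewrite AD_openE => _ ->; exact/principal_filterP.
move=> [U]; rewrite nbhsE => -[V [oV Vx] VU] UA.
exists (AD_basic_nbhs x V); last first.
  apply: subset_trans UA => q [[Vq q2]|[[Vq q2] qx]]; [left|right];
    by do ?split => //; exact: VU.
split; last by left.
rewrite AD_openE => -[y b] [[/= Vy ->]|[[/= Vy ->] yx]]; last first.
  by apply/principal_filterP; right.
have [->|yx] := eqVneq y x.
  by exists V => //; apply: open_nbhs_nbhs.
exists (V `&` ~` [set x]).
  apply: filterI; first exact: open_nbhs_nbhs.
  apply: open_nbhs_nbhs; split; last exact/eqP.
  exact/closed_openC/accessible_closed_set1.
move=> [z c] [[/= [Vz zx] ->]|[[/= [Vz zx] ->] _]]; [left|right] => //.
by split=> // -[].
Qed.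

End AlexandroffDuplicate.

Definition star (Z : Type) (A : set Z) (P : set (set Z)) : set Z :=
  \bigcup_(B in [set B | P B /\ A `&` B !=set0]) B.

Definition open_cover (Z : topologicalType) (U : set (set Z)) : Prop :=
  U `<=` open /\ \bigcup_(A in U) A = setT.

Definition omega_cover (Z : topologicalType) (U : set (set Z)) : Prop :=
  open_cover U /\
  forall F : set Z, finite_set F -> exists2 A, U A & F `<=` A.

Definition scheepers (Z : topologicalType) : Prop :=
  forall U : nat -> set (set Z), (forall n, open_cover (U n)) ->
  exists V : nat -> set (set Z),
    (forall n, finite_set (V n) /\ V n `<=` U n) /\
    (omega_cover [set \bigcup_(A in V n) A | n in [set: nat]] \/
     exists n, \bigcup_(A in V n) A = setT).

Definition star_K_scheepers (Z : topologicalType) : Prop :=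
  forall U : nat -> set (set Z), (forall n, open_cover (U n)) ->
  exists K : nat -> set Z,
    (forall n, compact (K n)) /\
    omega_cover [set star (K n) (U n) | n in [set: nat]].

(* Main.v *)
Require Import Defs.
From mathcomp Require Import all_boot all_classical topology.

(** An open set of [X] is small when its whole preimage in [AD X] is covered by
    the star of finitely many points. Small sets cover [X]: if a member of the
    cover contains the basic neighbourhood of [(x, 0)] given by [O], then it
    contains the preimage of [O] up to the single point [(x, 1)], so the star of
    [{(x, 0), (x, 1)}] contains all of it. Selecting finitely many small sets at
    each stage by the Scheepers property yields finite, hence compact, sets
    [K n]. *)

Local Open Scope classical_set_scope.

Lemma star_mono {Z : Type} {A B : set Z} {P : set (set Z)} :
  A `<=` B -> star A P `<=` star B P.
Proof.
move=> AB z [C [PC [a [Aa Ca]]] Cz]; exists C => //; split=> //.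
by exists a; split=> //; exact: AB.
Qed.

Lemma sub_star {Z : Type} (A : set Z) (P : set (set Z)) :
  \bigcup_(B in P) B = setT -> A `<=` star A P.
Proof.
move=> PT a Aa; have [B PB Ba] : (\bigcup_(B in P) B) a by rewrite PT.
by exists B => //; split=> //; exists a.
Qed.

Lemma open_star {Z : topologicalType} (A : set Z) (P : set (set Z)) :
  P `<=` open -> open (star A P).
Proof. by move=> oP; apply: bigcup_open => B [/oP]. Qed.

(** Singletons are finite, so the condition on finite sets already yields a cover. *)
Lemma omega_coverP {Z : topologicalType} (U : set (set Z)) :
  U `<=` open ->
  (forall F : set Z, finite_set F -> exists2 A, U A & F `<=` A) ->
  omega_cover U.
Proof.
move=> oU UF; split=> //; split=> //; rewrite -subTset => z _.
have [A UA zA] := UF [set z] (finite_set1 z).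
by exists A => //; exact: zA.
Qed.

Definition small_open {X : topologicalType} (U : set (set (AD X))) :
    set (set X) :=
  [set O | open O /\ exists K : set (AD X),
    finite_set K /\ fst @^-1` O `<=` star K U].

Lemma small_open_cover {X : topologicalType} {U : set (set (AD X))} :
  open_cover U -> open_cover (small_open U).
Proof.
move=> [oU UT]; split; first by move=> O [].
rewrite -subTset => x _.
have [B UB Bx] : (\bigcup_(B in U) B) (x, false) by rewrite UT.
have := oU _ UB; rewrite AD_openE => /(_ _ Bx).
rewrite /AD_local /= => -[N]; rewrite nbhsE => -[O [oO Ox] ON] NB.
exists O => //; split=> //; exists [set (x, false); (x, true)].
split; first exact: finite_set2.
move=> [y b] /= Oy.
(* Only [(x, true)] may escape [B]; it is in the star as a point of the finite set. Other points are
   in [B], which meets that set at [(x, false)]. *)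
have [yx|yx] := pselect ((y, b) = (x, true)).
  by apply: sub_star => //; right.
exists B; first by split=> //; exists (x, false); split=> //; left.
by apply: NB; case: b yx => yx; [right; split=> //|left]; split=> //; exact: ON.
Qed.

Theorem corollary4p3 (X : topologicalType) (hX : scheepers X) :
  star_K_scheepers (AD X).
Proof.
move=> U Ucov.
have [V [VP Vcov]] := hX _ (fun n => small_open_cover (Ucov n)).
(* Smallness depends on the stage, hence the choice over pairs; [set0] is a dummy value where the
   set is not small. *)
have /choice[k kP] (p : nat * set X) : exists K : set (AD X),
    small_open (U p.1) p.2 ->
    finite_set K /\ fst @^-1` p.2 `<=` star K (U p.1).
  have [[_ [K KP]]|np] := pselect (small_open (U p.1) p.2); first by exists K.
  by exists set0 => /np.
pose K n := \bigcup_(A in V n) k (n, A).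
have starK n : fst @^-1` (\bigcup_(A in V n) A) `<=` star (K n) (U n).
  move=> q [A VA Aq]; have [_ kA] := kP (n, A) ((VP n).2 _ VA).
  by apply: star_mono (kA q Aq); exact: bigcup_sup.
exists K; split=> [n|].
  apply: finite_compact; apply: bigcup_finite; first exact: (VP n).1.
  by move=> A /(VP n).2 VA; have [] := kP (n, A) VA.
apply: omega_coverP => [_ [n _ <-]|F finF].
  exact/open_star/(Ucov n).1.
(* The finite set [F] has finitely many first coordinates, so an omega-cover captures them at one
   stage; a stage whose union is all of [X] serves every [F]. *)
have [n Fn] : exists n, fst @` F `<=` \bigcup_(A in V n) A.
  case: Vcov => [[_ /(_ _ (finite_image fst finF))[_ [n _ <-] Fn]]|[n VT]].
    by exists n.
  by exists n; rewrite VT.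
exists (star (K n) (U n)); first by exists n.
by move=> q Fq; apply/starK/Fn; exists q.
Qed.
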